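(* (1) Let $a,b$ be natural numbers such that $ab$ is stable, $\|a\|+\|b\|=\|ab\|+1$, $b>1$, and $a$ is stable. Then there exists $K$ such that for all $k\ge K$, \[\|b(a3^k+1)\|=\|a\|+\|b\|+3k+1.\] (2) If in addition $b$ is also stable, then there exists $K$ such that for all $k\ge K$ and all $\ell\ge0$, \[\|b(a3^k+1)3^\ell\|=\|a\|+\|b\|+3k+3\ell+1.\] Moreover, in both cases such a $K$ can be computed algorithmically from $a$ and $b$.
   Context: For a natural number $n$, $\|n\|$ denotes its integer complexity: the least number of $1$'s needed to write $n$ using only the constant $1$, addition, multiplication, and parentheses. A natural number $n$ is stable if $\|3^kn\|=3k+\|n\|$ for every $k\ge0$. *)

(* Defs.v *)
From mathcomp Require Import all_boot.
From mathcomp Require Import boolp.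

Set Implicit Arguments.
Unset Strict Implicit.
Unset Printing Implicit Defensive.

Inductive expr : Type :=
| One
| Add (e1 e2 : expr)
| Mul (e1 e2 : expr).

Fixpoint value (e : expr) : nat :=
  match e with
  | One => 1
  | Add e1 e2 => value e1 + value e2
  | Mul e1 e2 => value e1 * value e2
  end.

Fixpoint ones (e : expr) : nat :=
  match e with
  | One => 1
  | Add e1 e2 | Mul e1 e2 => ones e1 + ones e2
  end.

Definition writable (n m : nat) : Prop := exists e, value e = n /\ ones e = m.

Lemma writable_ex (n : nat) : exists m, `[< writable n.+1 m >].
Proof.
exists n.+1; apply/asboolP; elim: n => [|n [e [ve oe]]]; first by exists One.
by exists (Add e One); rewrite /= ve oe !addn1.
Qed.

(* No expression has value 0; [complexity 0 = 0] is a junk value. *)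
Definition complexity (n : nat) : nat :=
  if n is n'.+1 then ex_minn (writable_ex n') else 0.

Definition stable (n : nat) : Prop :=
  forall k, complexity (3 ^ k * n) = 3 * k + complexity n.

Lemma complexity_writable (n : nat) : 0 < n -> writable n (complexity n).
Proof. by case: n => // n _ /=; case: ex_minnP => m /asboolP. Qed.

Lemma complexity_min (e : expr) : complexity (value e) <= ones e.
Proof.
case Ee: (value e) => [//|n] /=; case: ex_minnP => m _; apply.
by apply/asboolP; exists e.
Qed.

Inductive recf : nat -> Type :=
| RZero n : recf n
| RSucc : recf 1
| RProj n (i : 'I_n) : recf n
| RComp k n (g : recf k) (h : 'I_k -> recf n) : recf n
| RPrec n (g : recf n) (h : recf n.+2) : recf n.+1
| RMu n (g : recf n.+1) : recf n.

(* [computes f v y]: the algorithm [f] halts on input [v] with output [y].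
   In [RPrec] the recursion variable is the first argument and the step function
   receives the index, the previous value, then the parameters; in [RMu] the
   variable searched for is the first argument of [g], which has to be defined
   at every smaller value. *)
Fixpoint computes n (f : recf n) : n.-tuple nat -> nat -> Prop :=
  match f in recf n return n.-tuple nat -> nat -> Prop with
  | RZero _ => fun _ y => y = 0
  | RSucc => fun v y => y = (thead v).+1
  | RProj _ i => fun v y => y = tnth v i
  | RComp k _ g h => fun v y =>
      exists w : k.-tuple nat,
        (forall i, computes (h i) v (tnth w i)) /\ computes g w y
  | RPrec _ g h => fun v y =>
      exists s : nat -> nat,
        [/\ computes g (behead_tuple v) (s 0),
            forall i, i < thead v ->
              computes h (cons_tuple i (cons_tuple (s i) (behead_tuple v)))
                (s i.+1)
          & y = s (thead v)]
  | RMu _ g => fun v y =>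
      computes g (cons_tuple y v) 0 /\
      forall i, i < y -> exists z, computes g (cons_tuple i v) z.+1
  end.

Lemma computes_fun n (f : recf n) v y z :
  computes f v y -> computes f v z -> y = z.
Proof.
elim: f v y z => [{}n|| {}n i|k {}n g IHg h IHh|{}n g IHg h IHh|{}n g IHg] v y z /=;
  try by move=> -> ->.
- case=> w [hw gw] [w' [hw' gw']].
  have ww : w = w' by apply: eq_from_tnth => i; apply: IHh (hw i) (hw' i).
  by rewrite -ww in gw'; apply: IHg gw gw'.
- case=> s [s0 sS ->] [s' [s0' sS' ->]].
  suff H i : i <= thead v -> s i = s' i by apply: H.
  elim: i => [_|i IHi lt_i]; first exact: IHg s0 s0'.
  have Hi := sS _ lt_i; rewrite (IHi (ltnW lt_i)) in Hi.
  exact: IHh Hi (sS' _ lt_i).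
- case=> gy ly [gz lz]; case: (ltngtP y z) => // lt_yz.
    by have [t /(IHg _ _ _ gy)] := lz _ lt_yz.
  by have [t /(IHg _ _ _ gz)] := ly _ lt_yz.
Qed.

(* Main.v *)
Require Import Defs.
From mathcomp Require Import all_boot zify.

(* Let N = ab and q = k + l, and suppose that n = b(a 3^k + 1)3^l = N 3^q + b 3^l
   has an expression with at most ||N|| + 3q + 1 ones.  As n^3 / 3^(ones) is
   bounded below independently of k and l, at every addition met from the root
   the smaller summand is bounded, and only boundedly many factors are not powers
   of 3.  Dropping the relatively tiny summands and keeping the other additions,
   whose values are then bounded, turns the expression into one of value u 3^m
   with u bounded and u 3^m relatively close to n.  Pigeonholing over a tower of
   scales gives a scale at which the error is small compared to 1/u, and then
   u 3^m = N 3^q once k is large.  By stability of N at most one summand y was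
   dropped, and ||y|| <= 1; so n = d(x + 1) with dx = N 3^q and d = b 3^l, hence
   x = a 3^k, and stability of a contradicts the bound on the number of ones.
   All bounds are explicit, which yields a computable threshold for k. *)

(** * Elementary bounds on complexity *)

Lemma ones_gt0 e : 0 < ones e.
Proof. by elim: e => //= e1 H1 e2 H2; rewrite addn_gt0 H1. Qed.

Lemma value_gt0 e : 0 < value e.
Proof. by elim: e => //= e1 H1 e2 H2; rewrite ?addn_gt0 ?muln_gt0 H1. Qed.

Lemma ones_gt1 e : 1 < value e -> 1 < ones e.
Proof.
by case: e => //= e1 e2 _; rewrite -[2]/(1 + 1) leq_add ?ones_gt0.
Qed.

Lemma complexity_gt0 n : 0 < n -> 0 < complexity n.
Proof. by case/complexity_writable=> e [_ <-]; exact: ones_gt0. Qed.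

Lemma complexity1 : complexity 1 = 1.
Proof. by apply/eqP; rewrite eqn_leq complexity_gt0 // (complexity_min One). Qed.

Lemma complexity_le1 n : 0 < n -> complexity n <= 1 -> n = 1.
Proof.
move=> n_gt0; have [e [ve <-]] := complexity_writable n_gt0.
by move: n_gt0 (@ones_gt1 e); rewrite ve; lia.
Qed.

Lemma complexityD m n : 0 < m -> 0 < n ->
  complexity (m + n) <= complexity m + complexity n.
Proof.
move=> /complexity_writable[e [<- <-]] /complexity_writable[e' [<- <-]].
exact: complexity_min (Add e e').
Qed.

Lemma complexityM m n : complexity (m * n) <= complexity m + complexity n.
Proof.
have [->|/complexity_writable[e [<- <-]]] := posnP m; first by [].
have [->|/complexity_writable[e' [<- <-]]] := posnP n; first by rewrite muln0.
exact: complexity_min (Mul e e').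
Qed.

Lemma complexity_leq n : complexity n <= n.
Proof.
elim: n => // -[_|n IHn]; first by rewrite complexity1.
by have := complexityD n.+1 1 isT isT; rewrite complexity1 addn1; lia.
Qed.

Lemma complexityM_exp3 n k : complexity (3 ^ k * n) <= 3 * k + complexity n.
Proof.
elim: k => [|k IHk]; first by rewrite mul1n.
by have := complexityM 3 (3 ^ k * n); have := complexity_leq 3;
  rewrite mulnA -expnS; lia.
Qed.

(** * Ordered expressions and the cubic bound on values *)

Fixpoint ordered (e : expr) : bool :=
  match e with
  | One => true
  | Add e1 e2 => [&& value e2 <= value e1, ordered e1 & ordered e2]
  | Mul e1 e2 => ordered e1 && ordered e2
  end.

Lemma ordered_ex e :
  exists2 e', ordered e' & value e' = value e /\ ones e' = ones e.
Proof.
elim: e => [|e1 [f1 of1 [v1 n1]] e2 [f2 of2 [v2 n2]]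
            |e1 [f1 of1 [v1 n1]] e2 [f2 of2 [v2 n2]]]; first by exists One.
- case: (leqP (value e2) (value e1)) => [le21|/ltnW le12].
    by exists (Add f1 f2); rewrite /= ?v1 ?v2 ?n1 ?n2 ?le21 ?of1 ?of2.
  exists (Add f2 f1); rewrite /= ?v1 ?v2 ?n1 ?n2 ?le12 ?of1 ?of2 //.
  by rewrite addnC [in RHS]addnC; split; rewrite // addnC.
- by exists (Mul f1 f2); rewrite /= ?of1 ?v1 ?v2 ?n1 ?n2.
Qed.

(** Besides the classical bound n^3 <= 3^(ones), a value that is not a power of 3 loses at least a
    factor 8/9, the worst case being 2 = 1 + 1. This loss bounds the number of such factors. *)
Lemma cube_value_exp3 e : ordered e ->
  value e ^ 3 <= 3 ^ ones e /\
  ((exists m, value e = 3 ^ m) \/ 9 * value e ^ 3 <= 8 * 3 ^ ones e).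
Proof.
elim: e => [_|e1 IH1 e2 IH2|e1 IH1 e2 IH2] /=; first by split => //; left; exists 0.
- case/and3P=> le21 /IH1[b1 _] /IH2[b2 _].
  have := ones_gt1 e2; have := ones_gt0 e2; have := value_gt0 e2.
  have := ones_gt1 e1; have := ones_gt0 e1; have := value_gt0 e1.
  move: (value e1) (value e2) (ones e1) (ones e2) b1 b2 le21.
  move=> v1 v2 o1 o2 b1 b2 le21 v1p o1p o1p' v2p o2p o2p'.
  have [v2_gt1|v2_le1] := ltnP 1 v2.
    have H : 3 ^ 2 <= 3 ^ o2 by rewrite leq_exp2l // o2p'.
    have H' : (v1 + v2) ^ 3 <= 8 * 3 ^ o1.
      have : (v1 + v2) ^ 3 <= (2 * v1) ^ 3 by rewrite leq_exp2r //; lia.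
      by rewrite expnMn; lia.
    rewrite expnD; set A := 3 ^ o1 in H' *; set B := 3 ^ o2 in H *.
    by split; [|right]; move: (_ ^ 3) H' H => W; nia.
  have {v2_le1 v2p} v2E : v2 = 1 by lia.
  have H : 3 ^ 1 <= 3 ^ o2 by rewrite leq_exp2l.
  have [v1_gt2|v1_le2] := ltnP 2 v1.
    have H' : 27 * (v1 + 1) ^ 3 <= 64 * 3 ^ o1.
      have : (3 * (v1 + 1)) ^ 3 <= (4 * v1) ^ 3 by rewrite leq_exp2r //; lia.
      by rewrite !expnMn; lia.
    rewrite v2E expnD; set A := 3 ^ o1 in H' *; set B := 3 ^ o2 in H *.
    by split; [|right]; move: (_ ^ 3) H' H => W; nia.
  have [v1E|v1E] : v1 = 1 \/ v1 = 2 by lia.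
    have H' : 3 ^ 1 <= 3 ^ o1 by rewrite leq_exp2l.
    by rewrite v1E v2E expnD; split; [|right]; nia.
  have H' : 3 ^ 2 <= 3 ^ o1 by rewrite leq_exp2l // o1p' // v1E.
  by rewrite v1E v2E expnD; split; [nia|left; exists 1].
- case/andP=> /IH1[b1 c1] /IH2[b2 c2]; rewrite expnD expnMn.
  split; first exact: leq_mul.
  case: c1 => [[m1 E1]|c1].
    case: c2 => [[m2 E2]|c2]; first by left; exists (m1 + m2); rewrite E1 E2 expnD.
    by right; rewrite mulnCA [8 * _]mulnCA leq_mul.
  by right; rewrite mulnA [8 * _]mulnA leq_mul.
Qed.

(** * Counting additions with a relatively small summand *)

(* No addition has its ratio of summands in [s, t), among those reached from the
   root without entering an addition of ratio less than 10 or a smaller summand. *)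
Fixpoint avoids (s t : nat) (e : expr) : bool :=
  match e with
  | One => true
  | Add e1 e2 => (10 * value e2 <= value e1) ==>
      ((value e1 < s * value e2) || (t * value e2 <= value e1)) && avoids s t e1
  | Mul e1 e2 => avoids s t e1 && avoids s t e2
  end.

(** (11/10)^3 < 2, whereas the ones of the small summand contribute at least 3, and 9 * 2 <= 8 * 3:
    a further factor 8/9 is lost. *)
Lemma cube_drop p v1 v2 o1 o2 : 10 * v2 <= v1 -> 0 < o2 ->
  9 ^ p * v1 ^ 3 <= 8 ^ p * 3 ^ o1 ->
  9 ^ p.+1 * (v1 + v2) ^ 3 <= 8 ^ p.+1 * 3 ^ (o1 + o2).
Proof.
move=> le21 o2p H; have H2 : 3 ^ 1 <= 3 ^ o2 by rewrite leq_exp2l.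
have H1 : 1000 * (v1 + v2) ^ 3 <= 1331 * v1 ^ 3.
  by have : (10 * (v1 + v2)) ^ 3 <= (11 * v1) ^ 3;
    [rewrite leq_exp2r //; lia | rewrite !expnMn; lia].
have {}H1 : (v1 + v2) ^ 3 <= 2 * v1 ^ 3 by lia.
rewrite !(expnS _ p) expnD -[9 * _ * _]mulnA -[8 * _ * _]mulnA [8 ^ p * _]mulnA.
have H3 : 9 ^ p * (v1 + v2) ^ 3 <= 2 * (8 ^ p * 3 ^ o1).
  by rewrite (leq_trans (leq_mul (leqnn _) H1)) // mulnCA leq_mul.
have H4 : 8 ^ p * 3 ^ o1 * 3 ^ 1 <= 8 ^ p * 3 ^ o1 * 3 ^ o2 by rewrite leq_mul.
set a := 9 ^ p * _ in H3 *; set c := 8 ^ p * _ in H3 H4 *; set d := c * 3 ^ o2 in H4 *.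
by move: a c d H3 H4 => a c d; lia.
Qed.

(** Each visited addition of ratio at least 10 loses a factor 8/9, and its ratio lies in at most one
    of the disjoint intervals [t i, t (i+1)); so [p] bounds the number of intervals hit, whatever
    [m] is. *)
Lemma count_gaps (t : nat -> nat) e : {homo t : i j / i <= j} -> ordered e ->
  exists2 p, 9 ^ p * value e ^ 3 <= 8 ^ p * 3 ^ ones e &
    forall m, count (fun i => ~~ avoids (t i) (t i.+1) e) (iota 0 m) <= p.
Proof.
move=> t_mono; elim: e => [_|e1 IH1 e2 IH2|e1 IH1 e2 IH2] /=.
- by exists 0 => // m; rewrite leqNgt -has_count; apply/hasPn.
- move=> oe; case/and3P: (oe) => _ /IH1[p Hp Hc] _.
  case: (leqP (10 * value e2) (value e1)) => [le21|lt12]; last first.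
    exists 0; first by rewrite !mul1n; case: (cube_value_exp3 (Add e1 e2) oe).
    by move=> m; rewrite leqNgt -has_count; apply/hasPn.
  exists p.+1; first by apply: cube_drop; rewrite ?ones_gt0.
  move=> m; pose a i := t i * value e2 <= value e1 < t i.+1 * value e2.
  pose b i := ~~ avoids (t i) (t i.+1) e1.
  rewrite (@eq_count _ _ (predU a b)) => [|i]; last first.
    by rewrite /= negb_and negb_or -leqNgt -ltnNge.
  have := count_predUI a b (iota 0 m); have := Hc m; rewrite -/b.
  suff : count a (iota 0 m) <= 1 by lia.
  have := filter_uniq a (iota_uniq 0 m); rewrite -size_filter.
  have : all a (filter a (iota 0 m)) by exact: filter_all.
  case: (filter _ _) => [|x [|y r]] //= /and3P[/andP[x1 x2] /andP[y1 y2] _].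
  suff -> : x = y by rewrite inE eqxx.
  have key i j : i < j -> t j * value e2 <= value e1 ->
      value e1 < t i.+1 * value e2 -> False.
    move=> /t_mono tij le_j lt_i; have : t i.+1 * value e2 <= t j * value e2.
      by rewrite leq_mul2r tij orbT.
    by lia.
  case: (ltngtP x y) => // [lt_xy|lt_yx]; first by case: (key x y).
  by case: (key y x).
- case/andP=> /IH1[p1 H1 C1] /IH2[p2 H2 C2]; exists (p1 + p2).
    rewrite !(expnD _ p1 p2) expnD expnMn mulnACA.
    by rewrite [leqRHS]mulnACA leq_mul.
  move=> m; apply: leq_trans (leq_add (C1 m) (C2 m)).
  rewrite -count_predUI (leq_trans _ (leq_addr _ _)) //; apply: sub_count => i /=.
  by rewrite negb_and.
Qed.

(** * Dropping summands and the ones thereby saved *)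

(* Multiplying by 1 is free, whereas writing 1 costs 1. *)
Definition factor_cost (d : nat) : nat := if d == 1 then 0 else complexity d.

Lemma factor_cost_leq d : factor_cost d <= complexity d.
Proof. by rewrite /factor_cost; case: eqP. Qed.

Lemma complexityMl d x : complexity (d * x) <= factor_cost d + complexity x.
Proof.
by rewrite /factor_cost; case: eqP => [->|_]; [rewrite mul1n | exact: complexityM].
Qed.

Lemma factor_costM c d : factor_cost (c * d) <= complexity c + factor_cost d.
Proof.
rewrite [factor_cost d]/factor_cost; case: eqP => [->|_].
  by rewrite muln1 addn0 factor_cost_leq.
exact: leq_trans (factor_cost_leq _) (complexityM _ _).
Qed.

(* Dropping zero, one, or at least two summands from an expression with [o] ones
   and value [n] leaves one of value [c]. *)
Inductive truncation (o n c : nat) : Prop :=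
| NoDrop of n = c & complexity c <= o
| OneDrop d x y of n = d * (x + y) & c = d * x & 0 < y &
    factor_cost d + complexity x + complexity y <= o
| TwoDrops of complexity c + 2 <= o.

Lemma truncation_leq o n c : truncation o n c ->
  [\/ n = c /\ complexity c <= o,
      exists d x y, [/\ n = d * (x + y), c = d * x, 0 < y &
        factor_cost d + complexity x + complexity y <= o] /\ complexity c + 1 <= o
    | complexity c + 2 <= o].
Proof.
case=> [nE le_o|d x y nE cE y_gt0 le_o|le_o]; [by constructor 1 | | by constructor 3].
constructor 2; exists d, x, y; split=> //; rewrite cE.
by have := complexityMl d x; have := complexity_gt0 _ y_gt0; lia.
Qed.

(** Savings add up. With a single drop in all, the untouched factor joins [d]; drops on both sides
    fall under [TwoDrops]. *)
Lemma truncationM o1 n1 c1 o2 n2 c2 :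
  truncation o1 n1 c1 -> truncation o2 n2 c2 ->
  truncation (o1 + o2) (n1 * n2) (c1 * c2).
Proof.
move=> /truncation_leq T1 /truncation_leq T2; have le12 := complexityM c1 c2.
case: T1 => [[-> le1]|[d [x [y [[-> E1 y1 le1] le1']]]]|le1].
- case: T2 => [[-> le2]|[d' [x' [y' [[-> -> y1' le2] le2']]]]|le2].
  + by apply: NoDrop => //; lia.
  + apply: (@OneDrop _ _ _ (c1 * d') x' y'); rewrite ?mulnA //.
    by have := factor_costM c1 d'; lia.
  + by apply: TwoDrops; lia.
- case: T2 => [[-> le2]|[_ [_ [_ [_ le2']]]]|le2].
  + apply: (@OneDrop _ _ _ (c2 * d) x y) => //; first by rewrite mulnC mulnA.
      by rewrite E1 mulnC mulnA.
    by have := factor_costM c2 d; lia.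
  + by apply: TwoDrops; lia.
  + by apply: TwoDrops; lia.
- by apply: TwoDrops; case: T2 => [[_ le2]|[_ [_ [_ [_ le2']]]]|le2]; lia.
Qed.

(** A first drop has [d = 1], whose factor cost is 0; any earlier drop brings the saving to two. *)
Lemma truncation_drop o n c o' y : 0 < y -> complexity y <= o' ->
  truncation o n c -> truncation (o + o') (n + y) c.
Proof.
move=> y_gt0 le_o' /truncation_leq; have yc := complexity_gt0 _ y_gt0.
case=> [[-> le_o]|[_ [_ [_ [_ le_o]]]]|le_o]; [|by apply: TwoDrops; lia..].
by apply: (@OneDrop _ _ _ 1 c y); rewrite ?mul1n //= ?add0n leq_add.
Qed.

(** [3 ^ D] bounds 3^(ones) / n^3, a deficit that the visited subexpressions inherit. Powers of 3 go
    into [m]; any other sum that is kept is bounded and goes into [u]. Each such sum and each drop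
    adds one to [p] and costs a factor 8/9; a drop causes a relative error of at most 1/t. *)
Lemma truncate s t D e : 10 <= s -> ordered e -> avoids s t e ->
  3 ^ ones e <= 3 ^ D * value e ^ 3 ->
  exists u m p,
    [/\ u <= ((s + 1) * 3 ^ (D + 2)) ^ p,
        9 ^ p * value e ^ 3 <= 8 ^ p * 3 ^ ones e,
        u * 3 ^ m <= value e,
        value e * t <= u * 3 ^ m * t + p * value e
      & truncation (ones e) (value e) (u * 3 ^ m)].
Proof.
move=> s_ge10; have Q_gt0 : 0 < 3 ^ (D + 2) by rewrite expn_gt0.
elim: e => [|e1 IH1 e2 IH2|e1 IH1 e2 IH2].
- exists 1, 0, 0; split; rewrite ?muln1 ?mul1n ?addn0 //=.
  by apply: NoDrop; rewrite ?complexity1.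
- move=> oe ae De; have /and3P[le21 oe1 oe2] : ordered (Add e1 e2) by [].
  have [le31 _] := cube_value_exp3 _ oe1; have [le32 _] := cube_value_exp3 _ oe2.
  have v2_gt0 := value_gt0 e2; have o2_gt0 := ones_gt0 e2.
  (* The sum is at most twice [value e1], so the deficit leaves 3^(ones e2) <= 8 * 3^D. *)
  have v2_leQ : value e2 <= 3 ^ (D + 2).
    have le8 : value (Add e1 e2) ^ 3 <= 8 * value e1 ^ 3.
      by rewrite -[8]/(2 ^ 3) -expnMn leq_exp2r //=; lia.
    have : 3 ^ ones e2 <= 3 ^ (D + 2).
      rewrite -(@leq_pmul2l (3 ^ ones e1)) ?expn_gt0 // -expnD.
      apply: leq_trans De _; apply: leq_trans (leq_mul (leqnn _) le8) _.
      rewrite mulnA mulnC leq_mul // expnD leq_mul //.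
    apply: leq_trans; apply: leq_trans _ le32.
    by rewrite -{1}[value e2]expn1 leq_pexp2l.
  (* Below ratio [s] the whole sum is bounded and kept; otherwise [avoids] forces a ratio of at
     least [t], and [e2] is dropped. *)
  have [lt_s|ge_s] := ltnP (value e1) (s * value e2).
    have le_L : value (Add e1 e2) <= (s + 1) * 3 ^ (D + 2).
      have := leq_mul (leqnn (s + 1)) v2_leQ; rewrite /=; lia.
    have [] := cube_value_exp3 _ oe.
    move: (complexity_min (Add e1 e2)) le_L; move: (value _) (ones _) => n o.
    move=> le_o le_L le3 [[m nE]|le98].
      by exists 1, m, 0; split; rewrite ?mul1n -?nE ?addn0 //; apply: NoDrop.
    by exists n, 0, 1; split; rewrite ?muln1 ?leq_addr //; apply: NoDrop.
  have le10 : 10 * value e2 <= value e1 by nia.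
  move: ae; rewrite /= le10 /= ltnNge ge_s /= => /andP[ge_t ae1].
  have [] := IH1 oe1 ae1.
    have le3 : value (Add e1 e2) ^ 3 <= 3 * value e1 ^ 3.
      have : (10 * value (Add e1 e2)) ^ 3 <= (11 * value e1) ^ 3.
        by rewrite leq_exp2r //=; lia.
      by rewrite !expnMn; lia.
    have H2 : 3 ^ 1 <= 3 ^ ones e2 by rewrite leq_exp2l.
    rewrite -(@leq_pmul2r 3) //; apply: leq_trans (leq_mul (leqnn _) H2) _.
    by rewrite -expnD; apply: leq_trans De _; rewrite -mulnA leq_mul // mulnC.
  move=> u [m [p [le_u le_p le_c close T]]]; exists u, m, p.+1.
  have L_gt0 : 0 < (s + 1) * 3 ^ (D + 2) by rewrite muln_gt0 Q_gt0 addn1.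
  split.
  + by apply: leq_trans le_u _; rewrite leq_pexp2l.
  + exact: cube_drop.
  + by rewrite /=; lia.
  + by rewrite /= mulnDl; move: close; lia.
  + by apply: truncation_drop T => //; exact: complexity_min.
- move=> /andP[oe1 oe2] /andP[ae1 ae2] De.
  have [le31 _] := cube_value_exp3 _ oe1; have [le32 _] := cube_value_exp3 _ oe2.
  have De' : 3 ^ ones e1 * 3 ^ ones e2 <= 3 ^ D * (value e1 ^ 3 * value e2 ^ 3).
    by rewrite -expnD -expnMn.
  have [|u1 [m1 [p1 [A1 B1 C1 E1 T1]]]] := IH1 oe1 ae1.
    rewrite -(@leq_pmul2r (3 ^ ones e2)) ?expn_gt0 //.
    by apply: leq_trans De' _; rewrite mulnA leq_mul.
  have [|u2 [m2 [p2 [A2 B2 C2 E2 T2]]]] := IH2 oe2 ae2.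
    rewrite -(@leq_pmul2l (3 ^ ones e1)) ?expn_gt0 //.
    by apply: leq_trans De' _; rewrite mulnCA leq_mul.
  have cE : u1 * u2 * 3 ^ (m1 + m2) = (u1 * 3 ^ m1) * (u2 * 3 ^ m2).
    by rewrite expnD mulnACA.
  exists (u1 * u2), (m1 + m2), (p1 + p2); rewrite cE /=; split.
  + by rewrite expnD leq_mul.
  + rewrite !(expnD _ p1 p2) expnD expnMn mulnACA.
    by rewrite [leqRHS]mulnACA leq_mul.
  + exact: leq_mul.
  (* Relative errors add up: n1 n2 - c1 c2 = n2 (n1 - c1) + c1 (n2 - c2). *)
  + move: (u1 * _) (u2 * _) (value e1) (value e2) C1 C2 E1 E2 {T1 T2 cE De De'}.
    move=> c1 c2 n1 n2 {}le31 {}le32 E1 E2.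
    have F1 : n2 * (n1 * t) <= n2 * (c1 * t + p1 * n1) by rewrite leq_mul.
    have F2 : c1 * (n2 * t) <= c1 * (c2 * t + p2 * n2) by rewrite leq_mul.
    have F3 : c1 * (p2 * n2) <= n1 * (p2 * n2) by rewrite leq_mul.
    lia.
  + exact: truncationM.
Qed.

(** * Scales and the pigeonhole argument *)

(** Since (s + 1) 3^(D+2) <= s^2, the left side is at most s^(16 * 3^D + 1), and 27 * 3^D exceeds
    this exponent. *)
Lemma scale_step D s N : 0 < N -> N < 3 ^ D -> 3 ^ (D + 3) <= s ->
  (((s + 1) * 3 ^ (D + 2)) ^ (8 * 3 ^ D) + N + 1) * (8 * 3 ^ D) < s ^ 3 ^ (D + 3).
Proof.
have -> : 3 ^ (D + 3) = 27 * 3 ^ D by rewrite expnD mulnC.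
have -> : 3 ^ (D + 2) = 9 * 3 ^ D by rewrite expnD mulnC.
move=> N_gt0 ltN le_s; set P := 8 * 3 ^ D; set U := _ ^ P.
have s_gt1 : 1 < s by lia.
have le_U : U <= s ^ (2 * P).
  by rewrite expnM leq_exp2r -?mulnn; [nia | rewrite /P; lia].
have le_sU : s <= s ^ (2 * P) by rewrite -{1}[s]expn1 leq_exp2l // /P; lia.
apply: (@leq_ltn_trans (s ^ (2 * P).+1)); last by rewrite ltn_exp2l // /P; lia.
rewrite expnSr; apply: leq_trans (_ : (s ^ (2 * P) * 2) * P <= _).
  by rewrite leq_mul2r; apply/orP; right; lia.
by rewrite -mulnA leq_mul // /P; lia.
Qed.

(** Consecutive scales are as far apart as in [scale_step] when x = 3^(D+3). *)
Definition scale (x i : nat) : nat := x ^ x ^ i.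

Lemma scale_mono x : 0 < x -> {homo scale x : i j / i <= j}.
Proof. by move=> x_gt0 i j le_ij; rewrite /scale leq_pexp2l // leq_pexp2l. Qed.

Lemma scaleS x i : scale x i.+1 = scale x i ^ x.
Proof. by rewrite /scale expnSr expnM. Qed.

(** Bernoulli's inequality for (9/8)^p replaces a logarithm. *)
Lemma leq_exp_ratio p D : 9 ^ p <= 8 ^ p * 3 ^ D -> p <= 8 * 3 ^ D.
Proof.
have bernoulli : (8 + p) * 8 ^ p <= 8 * 9 ^ p.
  elim: p => // p IHp; rewrite !(expnS _ p).
  have : 9 * ((8 + p) * 8 ^ p) <= 9 * (8 * 9 ^ p) by rewrite leq_mul.
  by lia.
move=> le_p; have : (8 + p) * 8 ^ p <= 8 * 3 ^ D * 8 ^ p.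
  by apply: leq_trans bernoulli _; rewrite -mulnA [3 ^ D * _]mulnC leq_mul.
by rewrite leq_mul2r expn_eq0 /=; lia.
Qed.

Lemma exists_gap t D e : {homo t : i j / i <= j} -> ordered e ->
  3 ^ ones e <= 3 ^ D * value e ^ 3 ->
  exists2 i, i <= 8 * 3 ^ D & avoids (t i) (t i.+1) e.
Proof.
move=> t_mono oe De; have [p le_p le_count] := count_gaps t _ t_mono oe.
have {}le_p : p <= 8 * 3 ^ D.
  apply: leq_exp_ratio; rewrite -(@leq_pmul2r (value e ^ 3)).
    by apply: leq_trans le_p _; rewrite -mulnA leq_mul.
  by rewrite expn_gt0 value_gt0.
pose m := (8 * 3 ^ D).+1; have := le_count m.
have := count_predC (fun i => ~~ avoids (t i) (t i.+1) e) (iota 0 m).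
rewrite size_iota => cE lec.
have : has (predC (fun i => ~~ avoids (t i) (t i.+1) e)) (iota 0 m).
  by rewrite has_count; lia.
by case/hasP=> i; rewrite mem_iota /= negbK => lt_i ?; exists i.
Qed.

(** * Rigidity of the numbers u 3^m with u bounded *)

(** Divided by the smaller power of 3, the two numbers are distinct integers, the lesser at most
    [V]; so their ratio is at least (V+1)/V. *)
Lemma ratio_exp3 x y m q V : x <= V -> y <= V -> x * 3 ^ m < y * 3 ^ q ->
  (V + 1) * (x * 3 ^ m) <= V * (y * 3 ^ q).
Proof.
move=> le_x le_y; have [le_mq|/ltnW le_qm] := leqP m q.
  rewrite -(subnKC le_mq) expnD [3 ^ m * _]mulnC !mulnA.
  rewrite ltn_mul2r leq_mul2r expn_gt0 expn_eq0 /= -mulnA.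
  by move: (y * _) => z; nia.
rewrite -(subnKC le_qm) expnD [3 ^ q * _]mulnC !mulnA.
rewrite ltn_mul2r leq_mul2r expn_gt0 expn_eq0 /= -mulnA.
by move: (x * _) => z; nia.
Qed.

(** If u 3^m were below N 3^q, its relative distance to N 3^q + B would be at least 1/(V+1), more
    than the allowed P/t; if above, it would exceed N 3^q by at least 3^q / V > B. *)
Lemma truncation_exact u m N q B V p P t : 0 < N -> u <= V -> N <= V -> p <= P ->
  (V + 1) * P < t -> V * B < 3 ^ q ->
  u * 3 ^ m <= N * 3 ^ q + B ->
  (N * 3 ^ q + B) * t <= u * 3 ^ m * t + p * (N * 3 ^ q + B) ->
  0 < B -> u * 3 ^ m = N * 3 ^ q.
Proof.
move=> N_gt0 le_u le_N le_p lt_t lt_B le_c close B_gt0.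
case: (ltngtP (u * 3 ^ m) (N * 3 ^ q)) => // [lt_cM|lt_Mc].
  have := ratio_exp3 _ _ _ _ _ le_u le_N lt_cM.
  move: (u * _) (N * _) close {lt_cM le_c lt_B le_u} => c M close le_V.
  set n := M + B in close; have lt_n : M < n by rewrite /n; lia.
  have H1 : p * n <= P * n by rewrite leq_mul2r le_p orbT.
  have H2 : (V + 1) * (n * t) <= (V + 1) * (c * t + P * n) by rewrite leq_mul //; lia.
  have H3 : (V + 1) * c * t <= V * M * t by rewrite leq_mul.
  have H4 : V * M * t <= V * n * t by rewrite leq_mul // leq_mul // ltnW.
  have H5 : (V + 1) * P * n < t * n by rewrite ltn_mul2r lt_t andbT; lia.
  lia.
have := ratio_exp3 _ _ _ _ _ le_N le_u lt_Mc.
have : 3 ^ q <= N * 3 ^ q by rewrite leq_pmull.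
have : V * (u * 3 ^ m) <= V * (N * 3 ^ q + B) by rewrite leq_mul.
by rewrite mulnDr mulnDl; lia.
Qed.

(** * The explicit threshold and the value of the complexity beyond it *)

(** Here [x] is 3^(D+3) with D = ab + 1, and [scale x x] dominates every scale in use, as their
    indices are at most 8 * 3^D + 1. The factor [b] comes from the error term 3^l b. *)
Definition threshold (a b : nat) : nat :=
  let x := 3 ^ (a * b + 4) in b * scale x x.

(** Stability of [b] enters through its instance at [l], which is immediate for [l = 0]; this covers
    both statements at once. *)
Lemma complexity_geq a b k l : 0 < a -> 1 < b -> stable (a * b) ->
  complexity a + complexity b = complexity (a * b) + 1 -> stable a ->
  complexity (3 ^ l * b) = 3 * l + complexity b -> threshold a b <= k ->
  complexity a + complexity b + 3 * k + 3 * l + 1 <=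
    complexity (b * (a * 3 ^ k + 1) * 3 ^ l).
Proof.
move=> a_gt0 b_gt1 st_ab cE st_a st_b le_k; rewrite leqNgt; apply/negP => lt_c.
set N := a * b in st_ab cE le_k *; set q := l + k.
have N_gt0 : 0 < N by rewrite /N muln_gt0 a_gt0 ltnW.
pose B := 3 ^ l * b.
have B_gt0 : 0 < B by rewrite /B muln_gt0 expn_gt0 /= ltnW.
have nE : b * (a * 3 ^ k + 1) * 3 ^ l = N * 3 ^ q + B.
  by rewrite /N /q /B expnD; move: (3 ^ k) (3 ^ l) => y z; lia.
move: lt_c; rewrite nE => lt_c.
have [|e0 [v0 o0]] := @complexity_writable (N * 3 ^ q + B).
  by rewrite addn_gt0 B_gt0 orbT.
have [e oe [ve one]] := ordered_ex e0; rewrite v0 in ve; rewrite o0 in one.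
(* The expression has at most N + 1 + 3q ones and value at least 3^q, so N + 1 bounds the
   deficit. *)
pose D := N.+1; pose x := 3 ^ (D + 3); pose P := 8 * 3 ^ D.
have xE : x = 3 ^ (N + 4) by rewrite /x /D addSnnS.
have x_gt0 : 0 < x by rewrite expn_gt0.
have De : 3 ^ ones e <= 3 ^ D * value e ^ 3.
  apply: (@leq_trans (3 ^ (D + q * 3))).
    by rewrite leq_exp2l //; have := complexity_leq N; rewrite /D; lia.
  rewrite expnD expnM leq_mul // ve leq_exp2r //.
  by apply: leq_trans (leq_addr _ _); rewrite leq_pmull.
have [i le_i av] := exists_gap _ _ _ (scale_mono _ x_gt0) oe De.
have s_ge : x <= scale x i by rewrite -(expn1 x) leq_pexp2l // ?expn1 // expn_gt0 x_gt0.
have s_ge10 : 10 <= scale x i.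
  apply: leq_trans s_ge; rewrite /x expnD; have : 0 < 3 ^ D by rewrite expn_gt0.
  by lia.
have N_lt : N < 3 ^ D by apply: ltn_trans (ltnSn _) _; exact: ltn_expl.
have := scale_step _ _ _ N_gt0 N_lt s_ge; rewrite -/x -scaleS -/P.
have [u [m [p [le_u le_p le_c close T]]]] := truncate _ _ _ _ s_ge10 oe av De.
have {}le_p : p <= P.
  apply: leq_exp_ratio; rewrite -(@leq_pmul2r (value e ^ 3)).
    by apply: leq_trans le_p _; rewrite -mulnA leq_mul.
  by rewrite expn_gt0 value_gt0.
set U := _ ^ P => lt_t.
have {}le_u : u <= U by apply: leq_trans le_u _; rewrite leq_pexp2l // muln_gt0 addn1 expn_gt0.
(* Divided by 3^l this is (U + N) b < 3^k, which follows from [le_k] and k < 3^k. *)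
have lt_B : (U + N) * B < 3 ^ q.
  rewrite /B /q expnD mulnCA ltn_mul2l expn_gt0 /=.
  apply: leq_ltn_trans (ltn_expl k (isT : 1 < 3)); apply: leq_trans le_k.
  rewrite /threshold -xE mulnC leq_mul //.
  have le_S : scale x i.+1 <= scale x x.
    apply: scale_mono => //; apply: leq_ltn_trans le_i _.
    have : 0 < 3 ^ D by rewrite expn_gt0.
    by rewrite /x expnD; lia.
  have P_gt0 : 0 < P by rewrite muln_gt0 expn_gt0.
  apply: leq_trans le_S; apply: ltnW; apply: leq_ltn_trans lt_t.
  by apply: leq_trans (leq_pmulr _ P_gt0); lia.
rewrite ve in le_c close T; rewrite one in T.
have cM : u * 3 ^ m = N * 3 ^ q.
  apply: (@truncation_exact u m N q B (U + N) p P (scale x i.+1)) => //.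
  - exact: leq_trans le_u (leq_addr _ _).
  - exact: leq_addl.
have cN : complexity (N * 3 ^ q) = 3 * q + complexity N by rewrite mulnC st_ab.
(* Keeping everything would force B = 0, and two drops would leave N 3^q with fewer ones than
   stability of N allows. *)
move: T; rewrite cM => T; case: (T) => [||]; last by rewrite cN; lia.
  by move=> /eqP; rewrite -{2}[_ * _]addn0 eqn_add2l; lia.
move=> d y z nyz cdy z_gt0 le_o.
have zE : z = 1.
  apply: complexity_le1 => //; have := complexityMl d y; rewrite -cdy cN; lia.
have dE : d = B by rewrite cdy zE mulnDr muln1 in nyz; lia.
(* As b > 1, the factor [d] has its full cost [complexity d] instead of the 0 of a factor 1. *)
have d_gt1 : d != 1.
  have : 0 < 3 ^ l by rewrite expn_gt0.
  by rewrite dE /B; nia.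
have yE : y = 3 ^ k * a.
  have : B * y = B * (3 ^ k * a).
    by rewrite -dE -cdy dE /N /B /q expnD; move: (3 ^ k) (3 ^ l) => v w; lia.
  by move/eqP; rewrite eqn_pmul2l // => /eqP.
move: le_o; rewrite /factor_cost (negPf d_gt1) dE yE zE complexity1 st_a.
by have : complexity B = 3 * l + complexity b := st_b; lia.
Qed.

Lemma complexity_threshold a b k l : 0 < a -> 1 < b -> stable (a * b) ->
  complexity a + complexity b = complexity (a * b) + 1 -> stable a ->
  complexity (3 ^ l * b) = 3 * l + complexity b -> threshold a b <= k ->
  complexity (b * (a * 3 ^ k + 1) * 3 ^ l) =
    complexity a + complexity b + 3 * k + 3 * l + 1.
Proof.
move=> a_gt0 b_gt1 st_ab cE st_a st_b le_k.
apply/eqP; rewrite eqn_leq complexity_geq // andbT.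
rewrite [b * _]mulnC -mulnA mulnC [b * _]mulnC.
have a_k : 0 < a * 3 ^ k by rewrite muln_gt0 a_gt0 expn_gt0.
have := complexityM (3 ^ l * b) (a * 3 ^ k + 1); have := complexityD _ 1 a_k isT.
have := complexityM_exp3 b l; have := complexityM_exp3 a k.
by rewrite complexity1 [3 ^ k * a]mulnC; lia.
Qed.

(** * A recursive function computing the threshold *)

Definition rec_comp2 {n} (g : recf 2) (f1 f2 : recf n) : recf n :=
  RComp g (fun i : 'I_2 => if i == ord0 then f1 else f2).

Definition rec_succ {n} (f : recf n) : recf n := RComp RSucc (fun _ : 'I_1 => f).

Definition rec_const n c : recf n := iter c rec_succ (RZero n).

Definition rec_add : recf 2 :=
  RPrec (RProj (@Ordinal 1 0 isT)) (rec_succ (RProj (@Ordinal 3 1 isT))).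

Definition rec_mul : recf 2 :=
  RPrec (RZero 1)
    (rec_comp2 rec_add (RProj (@Ordinal 3 2 isT)) (RProj (@Ordinal 3 1 isT))).

(* The first argument is the exponent. *)
Definition rec_exp : recf 2 :=
  RPrec (rec_const 1 1)
    (rec_comp2 rec_mul (RProj (@Ordinal 3 2 isT)) (RProj (@Ordinal 3 1 isT))).

Lemma computes_comp2 {n} (g : recf 2) (f1 f2 : recf n) {v x y z} :
  computes f1 v x -> computes f2 v y -> computes g [tuple x; y] z ->
  computes (rec_comp2 g f1 f2) v z.
Proof.
move=> c1 c2 cg; exists [tuple x; y]; split=> // -[[|[|//]] lt_i2].
  by rewrite (tnth_nth 0).
by rewrite (tnth_nth 0).
Qed.

Lemma computes_succ {n} (f : recf n) v x :
  computes f v x -> computes (rec_succ f) v x.+1.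
Proof. by move=> cf; exists [tuple x]; split=> // i; rewrite ord1 (tnth_nth 0). Qed.

Lemma computes_const n c v : computes (rec_const n c) v c.
Proof. by elim: c => // c; exact: computes_succ. Qed.

Lemma computes_prec2 (g : recf 1) (h : recf 3) (F : nat -> nat -> nat) :
  (forall y, computes g [tuple y] (F 0 y)) ->
  (forall i y, computes h [tuple i; F i y; y] (F i.+1 y)) ->
  forall x y, computes (RPrec g h) [tuple x; y] (F x y).
Proof.
move=> cg ch x y; exists (F^~ y).
have -> : behead_tuple [tuple x; y] = [tuple y] by exact: val_inj.
split=> [||//]; first exact: cg.
by move=> i _; congr (computes h _ _): (ch i y); apply: val_inj.
Qed.

Lemma computes_add x y : computes rec_add [tuple x; y] (x + y).
Proof.
move: x y; apply: (@computes_prec2 _ _ addn) => [y|i y]; first by [].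
by apply: computes_succ; rewrite /= (tnth_nth 0).
Qed.

Lemma computes_mul x y : computes rec_mul [tuple x; y] (x * y).
Proof.
move: x y; apply: (@computes_prec2 _ _ muln) => [y|i y]; first by [].
apply: (@computes_comp2 _ _ _ _ _ y (i * y)); rewrite /= ?(tnth_nth 0) //.
by rewrite mulSn; exact: computes_add.
Qed.

Lemma computes_exp x y : computes rec_exp [tuple x; y] (y ^ x).
Proof.
move: x y; apply: (@computes_prec2 _ _ (fun x y => y ^ x)) => [y|i y].
  exact: computes_const.
apply: (@computes_comp2 _ _ _ _ _ y (y ^ i)); rewrite /= ?(tnth_nth 0) //.
by rewrite expnS; exact: computes_mul.
Qed.

(** As [rec_exp] takes the exponent first, its inner application to [x] and [x] is the exponent in
    [x ^ x ^ x]. *)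
Definition rec_threshold : recf 2 :=
  let a := RProj (@Ordinal 2 0 isT) in
  let b := RProj (@Ordinal 2 1 isT) in
  let x := rec_comp2 rec_exp
    (rec_comp2 rec_add (rec_comp2 rec_mul a b) (rec_const 2 4)) (rec_const 2 3) in
  rec_comp2 rec_mul b (rec_comp2 rec_exp (rec_comp2 rec_exp x x) x).

Lemma computes_threshold a b : computes rec_threshold [tuple a; b] (threshold a b).
Proof.
have ca : computes (RProj (@Ordinal 2 0 isT)) [tuple a; b] a by rewrite /= (tnth_nth 0).
have cb : computes (RProj (@Ordinal 2 1 isT)) [tuple a; b] b by rewrite /= (tnth_nth 0).
have cx := computes_comp2 _ _ _ (computes_comp2 _ _ _
  (computes_comp2 _ _ _ ca cb (computes_mul _ _)) (computes_const 2 4 _)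
  (computes_add _ _)) (computes_const 2 3 _) (computes_exp _ _).
exact: computes_comp2 _ _ _ cb (computes_comp2 _ _ _ (computes_comp2 _ _ _ cx cx
  (computes_exp _ _)) cx (computes_exp _ _)) (computes_mul _ _).
Qed.

Theorem theorem1p16 :
  (forall a b : nat, 0 < a -> 1 < b ->
     stable (a * b) -> complexity a + complexity b = complexity (a * b) + 1 ->
     stable a ->
     exists K : nat, forall k, K <= k ->
       complexity (b * (a * 3 ^ k + 1))
         = complexity a + complexity b + 3 * k + 1)
  /\
  (forall a b : nat, 0 < a -> 1 < b ->
     stable (a * b) -> complexity a + complexity b = complexity (a * b) + 1 ->
     stable a -> stable b ->
     exists K : nat, forall k l, K <= k ->
       complexity (b * (a * 3 ^ k + 1) * 3 ^ l)
         = complexity a + complexity b + 3 * k + 3 * l + 1)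
  /\
  (exists f : recf 2, forall a b : nat, 0 < a -> 1 < b ->
     stable (a * b) -> complexity a + complexity b = complexity (a * b) + 1 ->
     stable a ->
     exists K : nat, computes f [tuple a; b] K /\ forall k, K <= k ->
       complexity (b * (a * 3 ^ k + 1))
         = complexity a + complexity b + 3 * k + 1)
  /\
  (exists f : recf 2, forall a b : nat, 0 < a -> 1 < b ->
     stable (a * b) -> complexity a + complexity b = complexity (a * b) + 1 ->
     stable a -> stable b ->
     exists K : nat, computes f [tuple a; b] K /\ forall k l, K <= k ->
       complexity (b * (a * 3 ^ k + 1) * 3 ^ l)
         = complexity a + complexity b + 3 * k + 3 * l + 1).

Proof.
have H1 a b : 0 < a -> 1 < b -> stable (a * b) ->
    complexity a + complexity b = complexity (a * b) + 1 -> stable a ->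
    forall k, threshold a b <= k -> complexity (b * (a * 3 ^ k + 1))
      = complexity a + complexity b + 3 * k + 1.
  move=> a_gt0 b_gt1 st_ab cE st_a k le_k.
  by have := @complexity_threshold a b k 0 a_gt0 b_gt1 st_ab cE st_a;
     rewrite mul1n muln1 muln0 addn0; apply.
have H2 a b : 0 < a -> 1 < b -> stable (a * b) ->
    complexity a + complexity b = complexity (a * b) + 1 -> stable a -> stable b ->
    forall k l, threshold a b <= k -> complexity (b * (a * 3 ^ k + 1) * 3 ^ l)
      = complexity a + complexity b + 3 * k + 3 * l + 1.
  by move=> a_gt0 b_gt1 st_ab cE st_a st_b k l; exact: complexity_threshold.
split; first by move=> a b ? ? ? ? ?; exists (threshold a b); exact: H1.
split; first by move=> a b ? ? ? ? ? ?; exists (threshold a b); exact: H2.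
split; exists rec_threshold => a b *; exists (threshold a b);
  by split; [exact: computes_threshold | auto].
Qed.
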